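(* Let $p$ be a prime, let $k\geq 1$ be an integer, let $f\in F_p[x]$ be an irreducible polynomial of degree $k$, and let $K_f=F_p[x]/(f)$. Then every field automorphism of $K_f$ defines also a graph automorphism of the undirected graph $X_f$ and of the directed graph $\overrightarrow{X}_f$.
   Context: $F_p$ is the field with $p$ elements, and the class of the polynomial $x$ in $K_f=F_p[x]/(f)$ is again denoted $x$. Let $S=\{x,x^p,x^{p^2},\dots,x^{p^{k-1}}\}\subset K_f$ be the orbit of $x$ under the Frobenius automorphism $y\mapsto y^p$. The directed multigraph $\overrightarrow{X}_f$ has vertex set $K_f$ and the following edges. For all $y,z\in K_f$ and $s\in S$ with $z-y=s$ there is one (additive) edge from $y$ to $z$ corresponding to $s$. For all $y,z\in K_f\setminus\{0\}$ and $s\in S$ with $zy^{-1}=s$ there is one (multiplicative) edge from $y$ to $z$ corresponding to $s$. The undirected multigraph $X_f$ is obtained by forgetting the orientations of edges while keeping every edge. Graph morphisms are regarded as maps between vertex sets: an automorphism of $X_f$ (respectively $\overrightarrow{X}_f$) is a bijection $\phi$ of the vertex set such that for all vertices $u,v$ the number of edges joining $u$ and $v$ (respectively going from $u$ to $v$) equals the number of edges joining $\phi(u)$ and $\phi(v)$ (respectively going from $\phi(u)$ to $\phi(v)$). *)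

(* Defs.v *)
From HB Require Import structures.
From mathcomp Require Import all_boot all_order all_algebra all_field.

Set Implicit Arguments.
Unset Strict Implicit.
Unset Printing Implicit Defensive.

Import GRing.Theory.
Local Open Scope ring_scope.

Record directed_multigraph (V : finType) := DirectedMultigraph {
  arc : finType;
  source : arc -> V;
  target : arc -> V }.

(* The ends of an edge form a set of two vertices, or of one for a loop. *)
Record multigraph (V : finType) := Multigraph {
  edge : finType;
  ends : edge -> {set V};
  ends_card : forall e, (0 < #|ends e| <= 2)%N }.

Section Counting.

Variable V : finType.

Definition arcs_from_to (D : directed_multigraph V) (u v : V) : nat :=
  #|[set e : arc D | (source e == u) && (target e == v)]|.

Definition edges_joining (G : multigraph V) (u v : V) : nat :=
  #|[set e : edge G | ends e == [set u; v]]|.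

Definition is_directed_automorphism (D : directed_multigraph V) (phi : V -> V) :=
  bijective phi /\
  forall u v, arcs_from_to D u v = arcs_from_to D (phi u) (phi v).

Definition is_automorphism (G : multigraph V) (phi : V -> V) :=
  bijective phi /\
  forall u v, edges_joining G u v = edges_joining G (phi u) (phi v).

Lemma arc_ends_card (D : directed_multigraph V) (e : arc D) :
  (0 < #|[set source e; target e]| <= 2)%N.
Proof. by rewrite cards2; case: (_ != _). Qed.

Definition forget_orientation (D : directed_multigraph V) : multigraph V :=
  Multigraph (@arc_ends_card D).

End Counting.

(* The library forms F[x]/(h) for a monic irreducible h; f need not be monic,
   so we quotient by its monic associate, which generates the same ideal (see
   [residue_eq0] below). *)
Definition monic_associate (F : fieldType) (f : {poly F}) : {poly F} :=
  (lead_coef f)^-1 *: f.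

Section ResidueField.

Variables (F : finFieldType) (f : {poly F}).
Hypothesis f_irr : irreducible_poly f.

Lemma monic_associate_eqp : monic_associate f %= f.
Proof.
by rewrite eqp_scale // invr_eq0 lead_coef_eq0 irredp_neq0.
Qed.

Lemma monic_associate_irreducible :
  monic_irreducible_poly (monic_associate f).
Proof.
have f0 : lead_coef f != 0 by rewrite lead_coef_eq0 irredp_neq0.
split; last by rewrite monicE lead_coefZ mulVf.
have [f_gt1 f_div] := f_irr; split.
  by rewrite (eqp_size monic_associate_eqp).
move=> q q_size q_dvd; apply: (eqp_trans (f_div q q_size _)).
  by rewrite -(eqp_dvdr _ monic_associate_eqp).
by rewrite eqp_sym monic_associate_eqp.
Qed.

Local Notation K := {poly %/ _ with monic_associate_irreducible}.

Definition residue (q : {poly F}) : K :=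
  in_qpoly (monic_associate f) q.

Lemma residue_eq0 (q : {poly F}) : (residue q == 0) = (f %| q).
Proof.
rewrite -val_eqE /= (mk_monicE monic_associate_irreducible).
by rewrite -(eqp_dvdl _ monic_associate_eqp) Pdiv.Idomain.dvdpE.
Qed.

End ResidueField.

Notation residue_field f_irr :=
  {poly %/ _ with monic_associate_irreducible f_irr}.

Section Graphs.

Variables (p k : nat) (f : {poly 'F_p}) (f_irr : irreducible_poly f).

Local Notation K := (residue_field f_irr).

Definition frobenius_orbit : {set K} :=
  [set residue f_irr 'X ^+ (p ^ i) | i : 'I_k].

Definition is_additive_arc : pred (K * K * K) := fun '(y, z, s) =>
  (s \in frobenius_orbit) && (z - y == s).

Definition is_multiplicative_arc : pred (K * K * K) := fun '(y, z, s) =>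
  [&& y != 0, z != 0, s \in frobenius_orbit & z * y^-1 == s].

(* An arc is a triple (y, z, s), running from y to z and corresponding to s;
   the sum keeps an additive and a multiplicative arc with the same triple
   distinct. *)
Definition directed_graph : directed_multigraph K :=
  @DirectedMultigraph K
    ({e | is_additive_arc e} + {e | is_multiplicative_arc e})%type
    (fun a => match a with inl e => (val e).1.1 | inr e => (val e).1.1 end)
    (fun a => match a with inl e => (val e).1.2 | inr e => (val e).1.2 end).

Definition undirected_graph : multigraph K :=
  forget_orientation directed_graph.

End Graphs.

(* Main.v *)
Require Import Defs.
From HB Require Import structures.
From mathcomp Require Import all_boot all_order all_algebra all_field.

Set Implicit Arguments.
Unset Strict Implicit.
Unset Printing Implicit Defensive.

Import GRing.Theory.
Local Open Scope ring_scope.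

(* The polynomial with root set S (the Frobenius orbit of x) is invariant under
   Frobenius, so its coefficients lie in the prime field and are fixed by any
   field automorphism phi. Hence phi x is again a root, that is, phi x lies in
   S, and since phi commutes with Frobenius, phi permutes S. Applying phi to
   the three components of the arcs then permutes them, compatibly with phi on
   vertices. *)

(** The [p] elements [n%:R] with [n < p] are distinct roots of ['X^p - 'X], which has degree [p]. A
    fixed point [c] outside this list would be one root too many. *)
Lemma frobenius_fixed_nat (F : fieldType) (p : nat) (c : F) :
  p \in [pchar F] -> c ^+ p = c -> exists n : nat, c = n%:R.
Proof.
move=> pcharF c_fix; have p_gt1 := prime_gt1 (pcharf_prime pcharF).
pose rs : seq F := [seq n%:R | n <- iota 0 p].
have [/mapP[n _ ->] | c_notin] := boolP (c \in rs); first by exists n.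
have size_q : size ('X^p - 'X : {poly F}) = p.+1.
  by rewrite size_polyDl size_polyXn // size_polyN size_polyX.
have rs_uniq : uniq rs.
  rewrite map_inj_in_uniq ?iota_uniq // => m n.
  rewrite !mem_iota /= add0n => m_lt n_lt /eqP.
  wlog le_mn : m n m_lt n_lt / (m <= n)%N.
    move=> th; have [/th|/ltnW/th th'] := leqP m n; first exact.
    by rewrite eq_sym => /th' ->.
  (* Equal images mean that [p] divides [n - m], and [n - m < p] forces this difference to be 0. *)
  rewrite eq_sym -subr_eq0 -natrB // -(dvdn_pcharf pcharF).
  rewrite /dvdn modn_small ?subn_eq0 => [le_nm|].
    by apply/eqP; rewrite eqn_leq le_mn.
  exact: leq_ltn_trans (leq_subr _ _) n_lt.
have := @max_poly_roots _ ('X^p - 'X) (c :: rs).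
rewrite -size_poly_gt0 size_q /= c_notin rs_uniq size_map size_iota ltnn.
rewrite rootE !hornerE c_fix subrr eqxx /= => /(_ isT) th.
suff /th/(_ isT) : all (root ('X^p - 'X)) rs by [].
apply/allP=> _ /mapP[n _ ->].
by rewrite rootE !hornerE -(pFrobenius_autE pcharF) pFrobenius_aut_nat subrr.
Qed.

(** Raising to the power [p ^ k], the order of the field, is the identity, so [i] can be reduced
    modulo [k]. *)
Lemma frobenius_power_mem_orbit (F : finFieldType) (p k : nat) (x : F) (i : nat) :
  #|F| = (p ^ k)%N -> x ^+ (p ^ i) \in [set x ^+ (p ^ j) | j : 'I_k].
Proof.
move=> cardF.
have k_gt0 : (0 < k)%N by case: (k) cardF (finNzRing_gt1 F) => // ->.
apply/imsetP; exists (Ordinal (ltn_pmod i k_gt0)) => //=.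
rewrite {1}(divn_eq i k) expnD mulnC exprM mulnC expnM -cardF.
by elim: (i %/ k)%N => [|q IHq]; rewrite ?expr1 // expnSr exprM IHq expf_card.
Qed.

Lemma rmorph_mem_frobenius_orbit (F : finFieldType) (p k : nat)
    (phi : {rmorphism F -> F}) (x : F) :
  prime p -> #|F| = (p ^ k)%N ->
  phi x \in [set x ^+ (p ^ i) | i : 'I_k].
Proof.
move=> p_prime cardF; set S := [set _ | _ : _].
have pcharF : p \in [pchar F] := card_finPcharP cardF p_prime.
pose frob := pFrobenius_aut pcharF.
have frobS : frob @: S = S.
  (* Frobenius is injective and [S] is finite, so one inclusion suffices. *)
  apply/eqP; rewrite eqEcard card_imset ?leqnn ?andbT; last exact: fmorph_inj.
  apply/subsetP=> _ /imsetP[_ /imsetP[i _ ->] ->].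
  rewrite /frob pFrobenius_autE -exprM -expnSr.
  exact: frobenius_power_mem_orbit.
pose g : {poly F} := \prod_(s in S) ('X - s%:P).
have root_g y : root g y = (y \in S).
  by rewrite /g -big_enum root_prod_XsubC mem_enum.
have frob_g : map_poly frob g = g.
  rewrite rmorph_prod /= [in RHS]/g -[in RHS]frobS.
  rewrite (big_imset _ (in2W (fmorph_inj frob))) /=.
  by apply: eq_bigr => s _; rewrite map_polyXsubC.
have phi_g : map_poly phi g = g.
  apply/polyP=> i; rewrite coef_map /=.
  have [n ->] : exists n : nat, g`_i = n%:R.
    apply: (frobenius_fixed_nat pcharF).
    by rewrite -(pFrobenius_autE pcharF) -[in RHS]frob_g coef_map.
  exact: rmorph_nat.
rewrite -root_g -phi_g fmorph_root root_g.
(* It remains to see that [x] itself lies in [S]: it is the power with exponent [p ^ 0]. *)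
by rewrite -[x]expr1 (frobenius_power_mem_orbit x 0).
Qed.

Section ArcPermutation.

Variables (V : finType) (D : directed_multigraph V).
Variables (phi : V -> V) (h : Defs.arc D -> Defs.arc D).
Hypotheses (phi_bij : bijective phi) (h_inj : injective h).
Hypothesis source_h : forall a, source (h a) = phi (source a).
Hypothesis target_h : forall a, target (h a) = phi (target a).

(** An injective self-map of a finite type is bijective, and the arcs from [u] to [v] are the
    preimage under [h] of those from [phi u] to [phi v]. *)
Lemma directed_automorphism_of_arcs : is_directed_automorphism D phi.
Proof.
split=> // u v; have phi_inj := bij_inj phi_bij.
rewrite /arcs_from_to -[RHS](on_card_preimset (onW_bij _ (injF_bij h_inj))).
by apply: eq_card => a; rewrite !inE source_h target_h !(inj_eq phi_inj).
Qed.

Lemma automorphism_of_arcs : is_automorphism (forget_orientation D) phi.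
Proof.
split=> // u v; have phi_inj := bij_inj phi_bij.
rewrite /edges_joining -[RHS](on_card_preimset (onW_bij _ (injF_bij h_inj))).
apply: eq_card => a; rewrite !inE /= source_h target_h.
(* Both end sets are images under [phi], and taking images under an injection is injective on sets;
   loops need no separate case. *)
by rewrite -!imset_set1 -!imsetU (inj_eq (imset_inj phi_inj)).
Qed.

End ArcPermutation.

Section FieldAutomorphism.

Variables (p k : nat) (f : {poly 'F_p}) (f_irr : irreducible_poly f).
Hypotheses (p_prime : prime p) (f_deg : size f = k.+1).

Local Notation K := (residue_field f_irr).

Variable phi : {rmorphism K -> K}.

Lemma card_residue_field : #|{: K}| = (p ^ k)%N.
Proof.
by rewrite card_qfpoly card_Fp // (eqp_size (monic_associate_eqp f_irr)) f_deg.
Qed.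

Lemma rmorph_frobenius_orbit s :
  s \in frobenius_orbit k f_irr -> phi s \in frobenius_orbit k f_irr.
Proof.
have := rmorph_mem_frobenius_orbit phi (residue f_irr 'X) p_prime
  card_residue_field.
case/imsetP=> j _ phi_x /imsetP[i _ ->].
(* If [phi] sends the class of ['X] to its power [p ^ j], it sends the power [p ^ i] to the power
   [p ^ (j + i)]. *)
rewrite rmorphXn /= phi_x -exprM -expnD.
exact: frobenius_power_mem_orbit card_residue_field.
Qed.

Definition map_triple (e : K * K * K) : K * K * K :=
  (phi e.1.1, phi e.1.2, phi e.2).

Lemma map_triple_inj : injective map_triple.
Proof.
by move=> [[y z] s] [[y' z'] s'] [] /fmorph_inj-> /fmorph_inj-> /fmorph_inj->.
Qed.

Lemma map_triple_additive e :
  is_additive_arc k e -> is_additive_arc k (map_triple e).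
Proof.
case: e => [[y z] s] /= /andP[s_in /eqP z_sub_y].
by rewrite -rmorphB z_sub_y eqxx andbT rmorph_frobenius_orbit.
Qed.

Lemma map_triple_multiplicative e :
  is_multiplicative_arc k e -> is_multiplicative_arc k (map_triple e).
Proof.
case: e => [[y z] s] /= /and4P[y_neq0 z_neq0 s_in /eqP z_div_y].
by rewrite !fmorph_eq0 y_neq0 z_neq0 -fmorphV -rmorphM z_div_y eqxx andbT
  rmorph_frobenius_orbit.
Qed.

Definition map_arc (a : Defs.arc (directed_graph k f_irr)) :
    Defs.arc (directed_graph k f_irr) :=
  match a with
  | inl e => inl (exist _ (map_triple (val e)) (map_triple_additive (valP e)))
  | inr e => inr (exist _ (map_triple (val e)) (map_triple_multiplicative (valP e)))
  end.

Lemma map_arc_inj : injective map_arc.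
Proof.
(* The two kinds of arcs are never mixed, and within one kind an arc is determined by its triple. *)
by case=> [e|e] [e'|e'] //= [phi_y phi_z phi_s]; congr (_ _);
  apply/val_inj/map_triple_inj; rewrite /map_triple phi_y phi_z phi_s.
Qed.

End FieldAutomorphism.

Theorem proposition1 (p : nat) (p_prime : prime p) (k : nat) (k_ge1 : (1 <= k)%N)
    (f : {poly 'F_p}) (f_irr : irreducible_poly f) (f_deg : size f = k.+1)
    (phi : {rmorphism residue_field f_irr -> residue_field f_irr})
    (phi_bij : bijective phi) :
  is_automorphism (undirected_graph k f_irr) phi /\
  is_directed_automorphism (directed_graph k f_irr) phi.
Proof.
have h_inj := @map_arc_inj p k f f_irr p_prime f_deg phi.
split.
  (* Compatibility with sources and targets holds by computation on each kind of arc. *)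
  by rewrite /undirected_graph; apply: (automorphism_of_arcs phi_bij h_inj); case.
by apply: (directed_automorphism_of_arcs phi_bij h_inj); case.
Qed.
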